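(* Let $G$ be a locally compact, second countable, Hausdorff group, $r_0,R_0>0$ and $\sigma\ge1$. Then $(\mathcal U(r_0,\sigma),d_{wD})$ is a compact metric space, where $$d_{wD}:\mathcal U(r_0,\sigma)\times\mathcal U(r_0,\sigma)\to[0,\infty),\qquad d_{wD}(\Pi,\Xi):=\min\Big\{\frac{r_0}2,\ \frac{\sigma^{-1}}2,\ \delta_{wD}(\Pi,\Xi)\Big\},$$ and $d_{wD}$ induces the weak$^*$-topology on $\mathcal U(r_0,\sigma)$, viewing every $\Pi\in\mathcal U(r_0,\sigma)$ as the Radon measure $\mu_\Pi$. Furthermore, $\mathit{Del}(r_0,R_0,\sigma)\subseteq\mathcal U(r_0,\sigma)$ is a closed subset, and so $(\mathit{Del}(r_0,R_0,\sigma),d_{wD})$ is a compact metric space.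
   Context: $G$ is equipped with a fixed adapted metric $d_G$, i.e. a metric that is continuous (so it generates the topology), left-invariant, proper (closed balls are compact) and locally bounded. $B(x,r)$ and $\overline B(x,r)$ denote open and closed balls, and $B(r)=B(e,r)$. A set $P\subseteq G$ is $r_0$-uniformly discrete if $\sharp(B(x,r_0)\cap P)\le1$ for all $x\in G$, and $R_0$-relatively dense if $G=\bigcup_{x\in P}\overline B(x,R_0)$. A $\sigma$-weight of $P$ is a map $\alpha:P\to[\sigma^{-1},\sigma]$. $\mathcal U(r_0,\sigma)$ is the set of all pairs $(P,\alpha)$ with $P$ $r_0$-uniformly discrete and $\alpha$ a $\sigma$-weight of $P$. $\mathit{Del}(r_0,R_0,\sigma)$ is the set of those $(P,\alpha)\in\mathcal U(r_0,\sigma)$ with $P$ also $R_0$-relatively dense. For $\Pi=(P,\alpha)$ put $\mu_\Pi=\sum_{x\in P}\alpha(x)\delta_x$ (a Radon measure on the Borel sets of $G$) and $\operatorname{supp}(\Pi)=P$. Define $$\delta_{wD}(\Pi,\Xi)=\inf\Big\{\varepsilon>0:\ |\mu_\Pi(B(x,\varepsilon))-\mu_\Xi(B(x,\varepsilon))|<\varepsilon\ \text{ for all }x\in B(\tfrac1\varepsilon)\cap(\operatorname{supp}(\Pi)\cup\operatorname{supp}(\Xi))\Big\}\in[0,\infty],$$ with $\inf\emptyset=\infty$. The weak$^*$-topology on Radon measures is the coarsest topology making $\mu\mapsto\mu(\varphi)$ continuous for every $\varphi\in C_c(G)$. *)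

(* Defs.v *)
From HB Require Import structures.
From mathcomp Require Import all_boot all_order all_algebra.
From mathcomp Require Import finmap.
From mathcomp Require Import all_classical all_reals all_analysis.

Set Implicit Arguments.
Unset Strict Implicit.
Unset Printing Implicit Defensive.

Import Order.TTheory GRing.Theory Num.Theory.
Import numFieldNormedType.Exports.

Local Open Scope classical_set_scope.
Local Open Scope ring_scope.

HB.mixin Record Group_Topological_isTopologicalGroup G
    & Group G & Topological G := {
  mulg_continuous : continuous (fun xy : G * G => (xy.1 * xy.2)%g) ;
  invg_continuous : continuous (fun x : G => x^-1%g)
}.

#[short(type="topologicalGroupType")]
HB.structure Definition TopologicalGroup :=
  {G of Group G & Topological G & Group_Topological_isTopologicalGroup G}.

Record is_metric (R : realType) (X : Type) (d : X -> X -> R) : Prop := {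
  metric_ge0 : forall x y, 0 <= d x y ;
  metric_xx : forall x, d x x = 0 ;
  metric_eq0 : forall x y, d x y = 0 -> x = y ;
  metric_symm : forall x y, d x y = d y x ;
  metric_tri : forall y x z, d x z <= d x y + d y z
}.

(* The library metric space [X] with distance [d]; its topology is the one
   induced by [d]. *)
Definition metric_space (R : realType) (X : choiceType) (d : X -> X -> R)
  (dP : is_metric d) : Type := X.

HB.instance Definition _ (R : realType) (X : choiceType) (d : X -> X -> R)
  (dP : is_metric d) := Choice.on (metric_space dP).
HB.instance Definition _ (R : realType) (X : choiceType) (d : X -> X -> R)
  (dP : is_metric d) :=
  @isMetric.Build R (metric_space dP) d
    (metric_xx dP) (metric_eq0 dP) (metric_symm dP) (metric_tri dP).

Definition oball (R : realType) (X : Type) (d : X -> X -> R) (x : X) (r : R)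
  : set X := [set y | d x y < r].

Definition cball (R : realType) (X : Type) (d : X -> X -> R) (x : X) (r : R)
  : set X := [set y | d x y <= r].

Record adapted_metric (R : realType) (G : topologicalGroupType)
    (d : G -> G -> R) : Prop := {
  adapted_is_metric : is_metric d ;
  adapted_continuous : continuous (fun xy : G * G => d xy.1 xy.2) ;
  adapted_left_invariant : forall g x y : G, d (g * x)%g (g * y)%g = d x y ;
  adapted_proper : forall (x : G) (r : R), compact (cball d x r) ;
  adapted_locally_bounded : forall x : G, exists2 V : set G, nbhs x V &
    exists M : R, forall y z : G, V y -> V z -> d y z <= M
}.

(* A pair (P, alpha) with alpha defined on P only, so that Leibniz equality of
   weighted sets is equality of pairs. *)
Record weighted_set (R : realType) (G : Type) := WeightedSet {
  supp : set G ;
  weight : supp -> R ;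
  weight_gt0 : forall x : supp, 0 < weight x
}.

HB.instance Definition _ (R : realType) (G : Type) :=
  gen_eqMixin (weighted_set R G).
HB.instance Definition _ (R : realType) (G : Type) :=
  gen_choiceMixin (weighted_set R G).

Definition uniformly_discrete (R : realType) (G : Type) (d : G -> G -> R)
  (r0 : R) (P : set G) : Prop :=
  forall x : G, is_subset1 (oball d x r0 `&` P).

Definition relatively_dense (R : realType) (G : Type) (d : G -> G -> R)
  (R0 : R) (P : set G) : Prop :=
  [set: G] = \bigcup_(x in P) cball d x R0.

Definition calU (R : realType) (G : Type) (d : G -> G -> R) (r0 sigma : R)
  : set (weighted_set R G) :=
  [set Pi | uniformly_discrete d r0 (supp Pi) /\
            forall x : supp Pi, weight x \in `[sigma^-1, sigma]].

Definition Del (R : realType) (G : Type) (d : G -> G -> R) (r0 R0 sigma : R)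
  : set (weighted_set R G) :=
  [set Pi | calU d r0 sigma Pi /\ relatively_dense d R0 (supp Pi)].

Definition borel (G : topologicalGroupType) : Type := G.

Section borel_instance.
Context (G : topologicalGroupType).

HB.instance Definition _ := Choice.on (borel G).
HB.instance Definition _ := isPointed.Build (borel G) (1%g : G).
HB.instance Definition _ := @isMeasurable.Build (sigma_display (@open G))
  (borel G) <<s (@open G : set (set (borel G))) >>
  (@sigma_algebra0 _ setT _) (@sigma_algebraC _ _)
  (@sigma_algebra_bigcup _ setT _).

End borel_instance.

Section weighted_set_measure.
Local Open Scope ereal_scope.
Context (R : realType) (G : topologicalGroupType) (Pi : weighted_set R G).

Definition mu_of (A : set (borel G)) : \bar R :=
  \esum_(x in [set: supp Pi]) (weight x)%:E * \d_(val x : borel G) A.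

Lemma mu_of_term_ge0 (x : supp Pi) (A : set (borel G)) :
  0 <= (weight x)%:E * \d_(val x : borel G) A.
Proof. by rewrite mule_ge0// lee_fin ltW// weight_gt0. Qed.

Lemma mu_of0 : mu_of set0 = 0.
Proof. by apply: esum1 => x _; rewrite measure0 mule0. Qed.

Lemma mu_of_ge0 A : 0 <= mu_of A.
Proof. by apply: esum_ge0 => x _; exact: mu_of_term_ge0. Qed.

Lemma mu_of_sigma_additive : semi_sigma_additive mu_of.
Proof.
move=> F mF tF mUF.
rewrite [X in _ --> X](_ : _ = \sum_(i <oo) mu_of (F i)); last first.
  rewrite nneseries_esumT; last by move=> n; exact: mu_of_ge0.
  rewrite /mu_of esum_esum; last by move=> *; exact: mu_of_term_ge0.
  rewrite (@reindex_esum R _ _ ([set: supp Pi] `*`` (fun=> [set: nat]))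
    ([set: nat] `*`` (fun=> [set: supp Pi])) (fun k => (k.2, k.1))
    (fun k => (weight k.2)%:E * \d_(val k.2 : borel G) (F k.1)))/=; last first.
    split=> //.
    - by move=> [i j] [k l] _ _ /= [-> ->].
    - by move=> [i j] _; exists (j, i).
  rewrite -(@esum_esum _ _ _ [set: supp Pi] (fun=> [set: nat])
    (fun x i => (weight x)%:E * \d_(val x : borel G) (F i))); last first.
    by move=> *; exact: mu_of_term_ge0.
  apply: eq_esum => x _.
  rewrite -nneseries_esumT; last by move=> *; exact: mu_of_term_ge0.
  rewrite nneseriesZl; last by move=> *; exact: measure_ge0.
  by congr (_ * _); exact: measure_semi_bigcup.
by apply: is_cvg_ereal_nneg_natsum => k _; exact: mu_of_ge0.
Qed.

HB.instance Definition _ := isMeasure.Build _ _ _ mu_of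
  mu_of0 mu_of_ge0 mu_of_sigma_additive.

End weighted_set_measure.

Section radon_measures.
Local Open Scope ereal_scope.
Context (R : realType) (G : topologicalGroupType).

Record is_radon (mu : {measure set (borel G) -> \bar R}) : Prop := {
  radon_compact : forall K : set G, compact K -> mu K < +oo ;
  radon_outer : forall A : set (borel G), measurable A ->
    mu A = ereal_inf [set mu U | U in [set U : set G | open U /\ A `<=` U]] ;
  radon_inner : forall U : set G, open U ->
    mu U = ereal_sup [set mu K | K in [set K : set G | compact K /\ K `<=` U]]
}.

Record radon_measure := RadonMeasure {
  radon_mu :> {measure set (borel G) -> \bar R} ;
  radon_muP : is_radon radon_mu
}.

(* Real-valued; complex-valued test functions give the same weak* topology. *)
Definition Cc : set (G -> R) :=
  [set phi | continuous phi /\ compact (closure [set x | phi x != 0%R])].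

Definition radon_eval (mu : radon_measure) : {ptws Cc -> R} :=
  fun phi => (\int[mu]_x val phi x)%R.

HB.instance Definition _ := gen_eqMixin radon_measure.
HB.instance Definition _ := gen_choiceMixin radon_measure.

(* The coarsest topology making all the maps mu |-> mu(phi), phi in Cc,
   continuous: the topology pulled back from the product topology on R^Cc. *)
HB.instance Definition _ :=
  Topological.copy radon_measure (initial_topology radon_eval).

End radon_measures.

Section calU_radon.
Local Open Scope ereal_scope.
Context (R : realType) (G : topologicalGroupType) (d : G -> G -> R).
Context (dA : adapted_metric d).

Let dM : is_metric d := adapted_is_metric dA.

Lemma oball_open (x : G) (r : R) : open (oball d x r).
Proof.
have dx : continuous (d x).
  move=> y; apply: (@continuous_comp _ _ _ (fun z : G => (x, z))
    (fun xy : G * G => d xy.1 xy.2)); last exact: (adapted_continuous dA).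
  by apply: cvg_pair; [exact: cvg_cst|exact: cvg_id].
rewrite [oball _ _ _](_ : _ = d x @^-1` [set t | (t < r)%R]) //.
by apply: open_comp => [? _|]; [exact: dx|exact: open_lt].
Qed.

Lemma oball_center (x : G) (r : R) : (0 < r)%R -> oball d x r x.
Proof. by move=> r0; rewrite /oball/= (metric_xx dM). Qed.

Lemma uniformly_discrete_closed (r0 : R) (P Q : set G) : (0 < r0)%R ->
  uniformly_discrete d r0 P -> Q `<=` P -> closed Q.
Proof.
move=> r0_gt0 Pdisc QP p clQp.
have [q [Qq pq]] := clQp _ (open_nbhs_nbhs
  (conj (oball_open p r0) (oball_center p r0_gt0))).
have [<-//|qp] := pselect (q = p).
have dpq : (0 < d p q)%R.
  rewrite lt_neqAle (metric_ge0 dM) andbT eq_sym.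
  by apply/eqP => /(metric_eq0 dM) /esym.
have [q' [Qq' pq']] := clQp _ (open_nbhs_nbhs
  (conj (oball_open p (d p q)) (oball_center p dpq))).
have q'E : q' = q.
  apply: (Pdisc p); split; [|exact: QP|exact: pq|exact: QP].
  by rewrite /oball/= (lt_trans pq').
by move: pq'; rewrite q'E /oball/= ltxx.
Qed.

Lemma compact_coverG (K : set G) : compact K -> cover_compact K.
Proof.
pose X := isPointed.Build G (1%g : G).
pose pG : ptopologicalType := HB.pack (TopologicalGroup.sort G) X.
by rewrite (@compact_cover pG).
Qed.

Lemma uniformly_discrete_finite (r0 : R) (P K : set G) : (0 < r0)%R ->
  uniformly_discrete d r0 P -> compact K -> finite_set (K `&` P).
Proof.
move=> r0_gt0 Pdisc /compact_coverG Kc.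
have KU : K `<=` cover [set: G] (fun x => oball d x r0).
  by move=> x _; exists x => //; exact: oball_center.
have [D _ KD] := Kc G setT _ (fun x _ => oball_open x r0) KU.
have KPD : K `&` P `<=` \bigcup_(x in [set` D]) (oball d x r0 `&` P).
  by move=> x [/KD[y Dy yx] Px]; exists y.
apply: (sub_finite_set KPD).
apply: bigcup_finite; first exact: finite_fset.
move=> x _; have [->|/set0P[y yP]] := eqVneq (oball d x r0 `&` P) set0.
  exact: finite_set0.
have xPy : oball d x r0 `&` P `<=` [set y] by move=> z zP; exact: (Pdisc x).
exact: (sub_finite_set xPy (finite_set1 y)).
Qed.

Lemma mu_ofE (Pi : weighted_set R G) (A : set G) :
  mu_of Pi A = \esum_(x in [set x : supp Pi | A (val x)]) (weight x)%:E.
Proof.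
rewrite esum_mkcond /mu_of; apply: eq_esum => x _; rewrite diracE.
have [Ax|nAx] := pselect (A (val x)).
  by rewrite !mem_set// mule1.
by rewrite !memNset// mule0.
Qed.

Lemma mu_of_radon (r0 : R) (Pi : weighted_set R G) : (0 < r0)%R ->
  uniformly_discrete d r0 (supp Pi) -> is_radon (mu_of Pi).
Proof.
move=> r0_gt0 Pdisc; split.
- move=> K cK; change (mu_of Pi (K : set G) < +oo); rewrite mu_ofE.
  have fK : finite_set [set x : supp Pi | K (val x)].
    have := @finite_preimage (supp Pi) G _ val
      (fun x y _ _ => @val_inj _ _ _ x y)
      (uniformly_discrete_finite r0_gt0 Pdisc cK).
    by apply: sub_finite_set => x Kx; split => //; exact: set_valP.
  rewrite esum_fset//; last by move=> x _; rewrite lee_fin ltW// weight_gt0.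
  by rewrite fsumEFin// ltry.
- move=> A mA; apply/eqP; rewrite eq_le; apply/andP; split.
    apply: le_ereal_inf_tmp => _ [U [oU AU] <-].
    apply: le_measure => //; rewrite inE//; exact: sub_sigma_algebra.
  pose U : set G := ~` (supp Pi `\` A).
  have oU : open U.
    by apply: closed_openC; exact: (uniformly_discrete_closed r0_gt0 Pdisc).
  apply: ereal_inf_lbound; exists U.
    by split => // x Ax [].
  rewrite -[LHS]/(mu_of Pi (U : set G)) -[RHS]/(mu_of Pi (A : set G)) !mu_ofE.
  congr esum; apply/seteqP; split => x /=; last by move=> Ax [].
  by move=> Ux; apply: contrapT => nAx; apply: Ux; split => //; exact: set_valP.
- move=> U oU; apply/eqP; rewrite eq_le; apply/andP; split; last first.
    apply: ge_ereal_sup => _ [K [cK KU] <-].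
    rewrite -[leLHS]/(mu_of Pi (K : set G)) -[leRHS]/(mu_of Pi (U : set G)) !mu_ofE.
    apply: ge_ereal_sup => _ [X [finX XK] <-]; apply: esum_ge; exists X => //.
    by split => // x /XK /KU.
  rewrite -[leLHS]/(mu_of Pi (U : set G)) mu_ofE.
  apply: ge_ereal_sup => _ [X [finX XU] <-].
  pose K : set G := (val : supp Pi -> G) @` X.
  apply: (@le_trans _ _ (mu_of Pi (K : set G))); last first.
    apply: ereal_sup_ubound; exists K => //; split.
      by apply: finite_compact; exact: finite_image.
    by move=> _ [x /XU Ux <-].
  rewrite mu_ofE; apply: esum_ge; exists X => //.
  by split => // x Xx; exists x.
Qed.

Definition radon_of (r0 sigma : R) (r0_gt0 : (0 < r0)%R)
    (Pi : calU d r0 sigma) : radon_measure R G :=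
  RadonMeasure (mu_of_radon r0_gt0 (proj1 (set_valP Pi))).

End calU_radon.

Section wD.
Context (R : realType) (G : topologicalGroupType) (d : G -> G -> R).

Definition delta_wD (Pi Xi : weighted_set R G) : \bar R :=
  ereal_inf [set e%:E | e in [set e : R | 0 < e /\
    forall x : G, (oball d 1%g e^-1 `&` (supp Pi `|` supp Xi)) x ->
      (`|mu_of Pi (oball d x e) - mu_of Xi (oball d x e)| < e%:E)%E]].

(* [fine] loses nothing: the minimum lies between 0 and r0 / 2. *)
Definition d_wD (r0 sigma : R) (Pi Xi : weighted_set R G) : R :=
  fine (Order.min (Order.min (r0 / 2)%:E (sigma^-1 / 2)%:E) (delta_wD Pi Xi)).

End wD.

Definition restrict_dist (R : realType) (X : Type) (d : X -> X -> R)
  (A : set X) : A -> A -> R := fun x y => d (val x) (val y).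

(* Main.v *)
Require Import Defs.
From mathcomp Require Import all_boot all_order all_algebra.
From mathcomp Require Import all_classical all_reals all_analysis.
From mathcomp Require Import measurable_realfun finmap ring lra.

Set Implicit Arguments.
Unset Strict Implicit.
Unset Printing Implicit Defensive.

Import Order.TTheory GRing.Theory Num.Theory.
Import numFieldNormedType.Exports.

Local Open Scope classical_set_scope.
Local Open Scope ring_scope.

(** Fix [e <= min (r0, 1 / sigma)]. A ball of radius [e] contains at most one
    point of a set in [calU], and that point has mass at least [1 / sigma]. So
    if [x] is an atom of [Pi], the condition
    [|mu_Pi (B(x, e)) - mu_Xi (B(x, e))| < e] says that [Xi] has an atom within
    [e] of [x] whose weight differs by less than [e] ([mass_matched]). Below the
    cap [min (r0 / 2, 1 / (2 sigma))], the number [d_wD Pi Xi] is therefore the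
    infimum of the [e] for which the atoms of [Pi] and [Xi] in the ball of radius
    [1 / e] can be [matched] in both directions ([d_wD_ltP]). The relation
    [matched e] grows with [e] and composes with [e1 + e2 <= 1]
    ([matched_trans]); with discreteness, this gives the metric axioms
    ([d_wD_metric]).

    Compactness is proved with ultrafilters, which replace the diagonal
    extraction of subsequences. Given an ultrafilter on a family of weighted
    sets, the limit has as atoms the pairs (point, weight) that are approximated
    by atoms of almost every member of the family. It is again in [calU], since
    uniform discreteness and the bounds on the weights pass to the limit. Almost
    every member is [matched e] with it ([ulim]): in one direction because only
    finitely many atoms of the limit lie in the ball of radius [1 / e]; in the
    other because atoms left unmatched in almost every member would cluster, by
    compactness of closed balls, at an atom of the limit. Relative density
    passes to the limit as well ([Del_limit]), because only finitely many points
    of the limit lie near a given point of the group.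

    For the topology, if [phi] has compact support, then the atoms of [Xi] that
    [phi] sees are, for [Xi] near [Pi], in bijection with finitely many atoms of
    [Pi], and the finite sums that compute the integrals converge term by term
    ([Rintegral_cvg]). So the identity from [d_wD] to the weak* topology is
    continuous. Bump functions around a single atom show that the integrals
    determine the weighted set ([Rintegral_inj]), so the weak* topology is
    Hausdorff. A continuous bijection from a compact space to a Hausdorff space
    is a homeomorphism ([wD_weak_star]). *)

(** * Weighted sets as functions on the group, and matchings *)

Section weight_function.
Context (R : realType) (G : Type).
Implicit Types Pi Xi : weighted_set R G.

(** The weight extended by zero, so that weighted sets with different supports
    can be compared on all of [G]. *)
Definition wt Pi (x : G) : R :=
  if pselect (supp Pi x) is left Px then weight (SigSub (mem_set Px)) else 0.

Lemma wtE Pi (x : supp Pi) : wt Pi (val x) = weight x.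
Proof.
rewrite /wt; case: pselect => [Px|/(_ (set_valP x))//].
by congr weight; exact: val_inj.
Qed.

Lemma wt_out Pi x : ~ supp Pi x -> wt Pi x = 0.
Proof. by rewrite /wt; case: pselect. Qed.

Lemma wt_gt0 Pi x : supp Pi x <-> 0 < wt Pi x.
Proof.
rewrite /wt; case: pselect => Px; split => //; first by rewrite weight_gt0.
by rewrite ltxx.
Qed.

Lemma wt_ge0 Pi x : 0 <= wt Pi x.
Proof. by rewrite /wt; case: pselect => // Px; rewrite ltW// weight_gt0. Qed.

Lemma wt_inj Pi Xi : wt Pi =1 wt Xi -> Pi = Xi.
Proof.
move=> PX; have PXs : supp Pi = supp Xi.
  by apply/seteqP; split => x /wt_gt0 h; apply/wt_gt0; rewrite ?PX// -PX.
case: Pi Xi PX PXs => [P a a0] [Q b b0] /= PX PQ; subst Q.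
have ab : a = b.
  apply/funext => x; have := PX (val x).
  by rewrite (@wtE (WeightedSet a0)) (@wtE (WeightedSet b0)).
by subst b; congr WeightedSet; exact: Prop_irrelevance.
Qed.

Lemma weighted_set_of (P : set G) (w : G -> R) :
  (forall x, P x -> 0 < w x) ->
  exists2 Pi, supp Pi = P & forall x, P x -> wt Pi x = w x.
Proof.
move=> w0; pose Pi := WeightedSet (fun x : P => w0 (val x) (set_valP x)).
by exists Pi => // x Px; exact: (@wtE Pi (SigSub (mem_set Px))).
Qed.

End weight_function.

Lemma mu_of_wt (R : realType) (G : topologicalGroupType)
    (Pi : weighted_set R G) (A : set G) :
  (mu_of Pi A = \esum_(x in A) (wt Pi x)%:E)%E.
Proof.
rewrite mu_ofE esum_mkcond [RHS]esum_mkcond.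
rewrite [RHS](_ : _ = \esum_(x in supp Pi)
    (if x \in A then (wt Pi x)%:E else 0)%E); last first.
  rewrite [RHS]esum_mkcond; apply: eq_esum => x _.
  have [Px|nPx] := pselect (supp Pi x); first by rewrite [x \in supp _]mem_set.
  by rewrite [x \in supp _]memNset// wt_out// if_same.
rewrite (@reindex_esum R _ _ [set: supp Pi] (supp Pi) val).
- apply: eq_esum => x _; rewrite wtE.
  by congr (if _ then _ else _); apply/idP/idP; rewrite !inE.
- split.
  + by move=> x _; exact: set_valP.
  + by move=> x y _ _; exact: val_inj.
  + by move=> x Px; exists (SigSub (mem_set Px)).
Qed.

Section uniformly_discrete_weights.
Context (R : realType) (G : topologicalGroupType) (d : G -> G -> R).
Context (dM : is_metric d).
Implicit Types (Pi Xi : weighted_set R G) (e : R).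

Lemma calUP r0 sigma Pi : 1 <= sigma -> calU d r0 sigma Pi <->
  uniformly_discrete d r0 (supp Pi) /\
  forall x, supp Pi x -> sigma^-1 <= wt Pi x <= sigma.
Proof.
move=> s1; split => -[Pd Pw]; split => // x.
  by move=> Px; rewrite /wt; case: pselect => // p; have := Pw (SigSub (mem_set p));
    rewrite in_itv.
by rewrite in_itv/= -wtE; apply: Pw; exact: set_valP.
Qed.

Lemma mu_of_ball r0 Pi x y e : uniformly_discrete d r0 (supp Pi) -> e <= r0 ->
  supp Pi y -> d x y < e -> mu_of Pi (oball d x e) = (wt Pi y)%:E.
Proof.
move=> Pd er Py xy; rewrite mu_of_wt.
rewrite -[RHS](@esum_set1 _ _ y (fun z => (wt Pi z)%:E)) ?lee_fin ?wt_ge0//.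
rewrite esum_mkcond [RHS]esum_mkcond; apply: eq_esum => z _.
have [->|zy] := eqVneq z y; first by rewrite !mem_set.
rewrite [in RHS]memNset//; last by move/eqP; exact/negP.
case: ifPn => // /set_mem xz; rewrite wt_out// => Pz; move/eqP: zy; apply.
by apply: (Pd x); split => //; rewrite /oball/= (lt_le_trans _ er).
Qed.

Lemma mu_of_ball0 Pi x e : (forall y, supp Pi y -> ~ d x y < e) ->
  mu_of Pi (oball d x e) = 0%E.
Proof.
move=> xP; rewrite mu_of_wt; apply: esum1 => y xy.
by rewrite wt_out// => /xP; exact.
Qed.

(** Outside the ball of radius [1 / e] nothing is required: it is this window
    that makes the distance a local one, and the space compact. *)
Definition shadowed e Pi Xi := forall x, supp Pi x -> d 1%g x < e^-1 ->
  exists y, [/\ supp Xi y, d x y < e & `|wt Pi x - wt Xi y| < e].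

Definition matched e Pi Xi := shadowed e Pi Xi /\ shadowed e Xi Pi.

Lemma matched_sym e Pi Xi : matched e Pi Xi -> matched e Xi Pi.
Proof. by case. Qed.

Lemma matched_refl e Pi : 0 < e -> matched e Pi Pi.
Proof.
by move=> e0; split => x Px _; exists x; rewrite (metric_xx dM) subrr normr0.
Qed.

Lemma matched_le e e' Pi Xi : 0 < e -> e <= e' ->
  matched e Pi Xi -> matched e' Pi Xi.
Proof.
move=> e0 ee'; have e'0 := lt_le_trans e0 ee'.
have mono (Th Om : weighted_set R G) : shadowed e Th Om -> shadowed e' Th Om.
  move=> TO x Tx xe; have [|y [Oy xy w]] := TO x Tx.
    by rewrite (lt_le_trans xe)// lef_pV2.
  by exists y; split => //; apply: lt_le_trans ee'.
by case=> /mono ? /mono.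
Qed.

(** The radius [1 / (e1 + e2)] leaves room for one step: if [x] lies in the ball
    of that radius and [y] is within [e1] of [x], then [y] lies in the ball of
    radius [1 / e2], provided that [e2 * (e1 + e2) <= 1]. *)
Lemma shadowed_trans e1 e2 Pi Xi Th : 0 < e1 -> 0 < e2 -> e1 + e2 <= 1 ->
  shadowed e1 Pi Xi -> shadowed e2 Xi Th -> shadowed (e1 + e2) Pi Th.
Proof.
move=> e10 e20 e12 PX XT x Px xe.
have e0 : 0 < e1 + e2 by rewrite addr_gt0.
have room : (e1 + e2)^-1 + e1 <= e2^-1.
  have -> : e2^-1 = (e1 + e2)^-1 + e1 * (e2^-1 * (e1 + e2)^-1).
    field; rewrite !gt_eqF//.
  rewrite lerD2l ler_pMr// -invfM invf_ge1 ?mulr_gt0//.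
  by rewrite mulr_ile1 ?(ltW e20) ?(ltW e0)//; lra.
have [|y [Xy xy wxy]] := PX x Px.
  by rewrite (lt_le_trans xe)// lef_pV2// ?posrE//; lra.
have [|z [Tz yz wyz]] := XT y Xy.
  apply: lt_le_trans room; apply: le_lt_trans (metric_tri dM x _ _) _.
  exact: ltrD.
exists z; split => //.
  by apply: le_lt_trans (metric_tri dM y _ _) _; exact: ltrD.
by apply: le_lt_trans (ler_distD (wt Xi y) _ _) _; exact: ltrD.
Qed.

Lemma matched_trans e1 e2 Pi Xi Th : 0 < e1 -> 0 < e2 -> e1 + e2 <= 1 ->
  matched e1 Pi Xi -> matched e2 Xi Th -> matched (e1 + e2) Pi Th.
Proof.
move=> e10 e20 e12 [PX XP] [XT TX]; split.
  exact: shadowed_trans PX XT.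
by rewrite addrC; apply: shadowed_trans TX XP => //; rewrite addrC.
Qed.

End uniformly_discrete_weights.

(** * The distance in terms of matchings, and the metric axioms *)

Section wD_metric.
Context (R : realType) (G : topologicalGroupType) (d : G -> G -> R).
Context (dM : is_metric d) (r0 sigma : R).
Context (r0_gt0 : 0 < r0) (sigma_ge1 : 1 <= sigma).
Implicit Types (Pi Xi Th : weighted_set R G) (e t : R).

Let U : set (weighted_set R G) := calU d r0 sigma.

(** Since [e <= r0], the ball holds exactly one atom of [Pi] and at most one of
    [Xi]. If it holds none, then the masses differ by the whole weight of [x],
    which is at least [1 / sigma >= e]. *)
Lemma mass_matched Pi Xi x e : U Pi -> U Xi -> supp Pi x ->
  0 < e -> e <= r0 -> e <= sigma^-1 ->
  (`|mu_of Pi (oball d x e) - mu_of Xi (oball d x e)| < e%:E)%E <->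
  exists y, [/\ supp Xi y, d x y < e & `|wt Pi x - wt Xi y| < e].
Proof.
move=> /(calUP _ _ _ sigma_ge1)[Pd Pw] /(calUP _ _ _ sigma_ge1)[Xd Xw] Px e0 er es.
rewrite (mu_of_ball Pd er Px) ?(metric_xx dM)//.
split=> [|[y [Xy xy]]]; last first.
  by rewrite (mu_of_ball Xd er Xy xy) -EFinB abse_EFin lte_fin.
have [[y [Xy xy]]|noy] := pselect (exists y, supp Xi y /\ d x y < e).
  rewrite (mu_of_ball Xd er Xy xy) -EFinB abse_EFin lte_fin.
  by exists y.
rewrite mu_of_ball0; last by move=> y Xy xy; apply: noy; exists y.
rewrite sube0 abse_EFin lte_fin (ger0_norm (wt_ge0 _ _)) => wxe.
by have /andP[+ _] := Pw x Px; rewrite leNgt (lt_le_trans wxe).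
Qed.

Lemma wD_matched Pi Xi e : U Pi -> U Xi -> 0 < e -> e <= r0 -> e <= sigma^-1 ->
  (forall x, (oball d 1%g e^-1 `&` (supp Pi `|` supp Xi)) x ->
    (`|mu_of Pi (oball d x e) - mu_of Xi (oball d x e)| < e%:E)%E) <->
  matched d e Pi Xi.
Proof.
move=> UP UX e0 er es.
have abse_distC (a b : \bar R) : (`|a - b| = `|b - a|)%E.
  by case: a b => [a||] [b||]//=; rewrite distrC.
split=> [PX|[PX XP] x [xe [Px|Xx]]].
- by split=> x Px xe; apply/mass_matched => //;
    [|rewrite abse_distC]; apply: PX; split => //; [left|right].
- by apply/mass_matched => //; exact: PX.
- by rewrite abse_distC; apply/mass_matched => //; exact: XP.
Qed.

Definition cap : R := Order.min (r0 / 2) (sigma^-1 / 2).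

Lemma cap_gt0 : 0 < cap.
Proof. by rewrite lt_min !divr_gt0// invr_gt0 (lt_le_trans ltr01). Qed.

Lemma cap_le_r0 : cap <= r0 / 2. Proof. by rewrite ge_min lexx. Qed.

Lemma cap_le_sigma : cap <= sigma^-1 / 2.
Proof. by rewrite ge_min lexx orbT. Qed.

Lemma cap_le_half : cap <= 2^-1.
Proof.
rewrite (le_trans cap_le_sigma)// ler_pdivrMr// mulVf// invf_le1//.
exact: lt_le_trans sigma_ge1.
Qed.

Lemma d_wDE Pi Xi :
  ((d_wD d r0 sigma Pi Xi)%:E = Order.min cap%:E (delta_wD d Pi Xi))%E.
Proof.
rewrite /d_wD -EFin_min fineK// fin_numE; apply/andP; split.
  rewrite gt_eqF// (@lt_le_trans _ _ 0%E)// le_min lee_fin (ltW cap_gt0)/=.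
  by apply: le_ereal_inf_tmp => _ [e [/ltW e0 _] <-]; rewrite lee_fin.
by rewrite lt_eqF// (@le_lt_trans _ _ cap%:E) ?ltry// ge_min lexx.
Qed.

Lemma d_wD_ge0 Pi Xi : 0 <= d_wD d r0 sigma Pi Xi.
Proof.
rewrite -lee_fin d_wDE le_min lee_fin (ltW cap_gt0)/=.
by apply: le_ereal_inf_tmp => _ [e [/ltW e0 _] <-]; rewrite lee_fin.
Qed.

Lemma d_wD_le_cap Pi Xi : d_wD d r0 sigma Pi Xi <= cap.
Proof. by rewrite -lee_fin d_wDE ge_min lexx. Qed.

Lemma d_wD_ltP Pi Xi t : U Pi -> U Xi -> t <= cap ->
  d_wD d r0 sigma Pi Xi < t <-> exists e, [/\ 0 < e, e < t & matched d e Pi Xi].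
Proof.
move=> UP UX tc; have r0c := cap_le_r0; have sc := cap_le_sigma.
have s0 : 0 < sigma^-1 by rewrite invr_gt0 (lt_le_trans ltr01).
rewrite -lte_fin d_wDE gt_min lte_fin [cap < t]ltNge tc/=; split.
  move=> /ereal_inf_lt[_ [e [e0 Pe] <-]]; rewrite lte_fin => et.
  by exists e; split => //; apply/wD_matched => //; lra.
move=> [e [e0 et Pe]]; apply: (@le_lt_trans _ _ e%:E); last by rewrite lte_fin.
apply: ereal_inf_lbound; exists e => //; split => //.
by apply/wD_matched => //; lra.
Qed.

Lemma d_wD_lt_matched Pi Xi t : U Pi -> U Xi -> t <= cap ->
  d_wD d r0 sigma Pi Xi < t -> matched d t Pi Xi.
Proof.
by move=> UP UX tc /d_wD_ltP[]// e [e0 et]; apply: matched_le => //; exact: ltW.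
Qed.

Lemma matched_d_wD_le Pi Xi t : U Pi -> U Xi -> 0 < t ->
  matched d t Pi Xi -> d_wD d r0 sigma Pi Xi <= t.
Proof.
move=> UP UX t0 PX; have [ct|tc] := leP cap t.
  exact: le_trans (d_wD_le_cap _ _) ct.
apply/ler_addgt0Pr => e e0; have [ce|ec] := leP cap (t + e).
  exact: le_trans (d_wD_le_cap _ _) ce.
by rewrite ltW//; apply/d_wD_ltP => //; [exact: ltW|exists t; rewrite ltrDl].
Qed.

Lemma d_wD_sym_le Pi Xi : U Pi -> U Xi ->
  d_wD d r0 sigma Pi Xi <= d_wD d r0 sigma Xi Pi.
Proof.
move=> UP UX; apply/ler_addgt0Pr => e e0.
have [ce|ec] := leP cap (d_wD d r0 sigma Xi Pi + e).
  exact: le_trans (d_wD_le_cap _ _) ce.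
apply: matched_d_wD_le => //; first by rewrite ltr_wpDl// d_wD_ge0.
by apply: matched_sym; apply: d_wD_lt_matched; rewrite ?ltrDl// ltW.
Qed.

(** By discreteness, the point of [Xi] within [e] of [x] does not depend on [e],
    so its distance to [x] is zero. *)
Lemma matched_all_wt Pi Xi x : U Xi -> supp Pi x ->
  (forall e, 0 < e -> e <= cap -> matched d e Pi Xi) -> wt Pi x = wt Xi x.
Proof.
move=> /(calUP _ _ _ sigma_ge1)[Xd _] Px PX.
have near_x e : 0 < e -> exists y, [/\ supp Xi y, d x y < e, d x y < r0 &
    `|wt Pi x - wt Xi y| < e].
  move=> e0; have r0c := cap_le_r0; have c0 := cap_gt0.
  have M0 : 0 < d 1%g x + 1 by rewrite ltr_wpDl// (metric_ge0 dM).
  (* [x] has to lie in the window of radius [1 / e'] *)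
  pose e' := Order.min (Order.min e cap) (d 1%g x + 1)^-1.
  have e'0 : 0 < e' by rewrite lt_min lt_min e0 c0/= invr_gt0.
  have e'e : e' <= e by rewrite /e' ge_min ge_min lexx.
  have e'c : e' <= cap by rewrite /e' ge_min ge_min lexx orbT.
  have e'M : e' <= (d 1%g x + 1)^-1 by rewrite /e' ge_min lexx orbT.
  have [+ _] := PX e' e'0 e'c; move=> /(_ x Px)[|y [Xy xy wxy]].
    rewrite (@lt_le_trans _ _ (d 1%g x + 1))// ?ltrDl//.
    by rewrite -[leLHS]invrK lef_pV2// posrE invr_gt0.
  by exists y; split => //; lra.
have [z [Xz _ xz _]] := near_x 1 ltr01.
have onlyz y : supp Xi y -> d x y < r0 -> y = z.
  by move=> Xy xy; apply: (Xd x).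
have xz0 : x = z.
  apply: (metric_eq0 dM); apply/eqP; rewrite eq_le (metric_ge0 dM) andbT.
  apply/ler_addgt0Pr => e /near_x[y [Xy xye xyr _]].
  by rewrite add0r -(onlyz y)// ltW.
apply/eqP; rewrite -subr_eq0 -normr_eq0 eq_le normr_ge0 andbT.
apply/ler_addgt0Pr => e /near_x[y [Xy _ xyr wxy]].
by rewrite add0r [in wt Xi x]xz0 -(onlyz y)// ltW.
Qed.

Lemma d_wD_eq0 Pi Xi : U Pi -> U Xi -> d_wD d r0 sigma Pi Xi = 0 -> Pi = Xi.
Proof.
move=> UP UX PX0.
have PXe e : 0 < e -> e <= cap -> matched d e Pi Xi.
  by move=> e0 ec; apply: d_wD_lt_matched => //; rewrite PX0.
apply: wt_inj => x; have [Px|nPx] := pselect (supp Pi x).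
  exact: matched_all_wt PXe.
have [Xx|nXx] := pselect (supp Xi x); last by rewrite !wt_out.
by apply/esym; apply: matched_all_wt Xx _ => // e e0 ec; exact/matched_sym/PXe.
Qed.

Lemma d_wD_tri Xi Pi Th : U Pi -> U Xi -> U Th ->
  d_wD d r0 sigma Pi Th <= d_wD d r0 sigma Pi Xi + d_wD d r0 sigma Xi Th.
Proof.
move=> UP UX UT; apply/ler_addgt0Pr => e e0.
set a := d_wD _ _ _ Pi Xi; set b := d_wD _ _ _ Xi Th.
have a0 : 0 <= a := d_wD_ge0 _ _; have b0 : 0 <= b := d_wD_ge0 _ _.
have [ce|ec] := leP cap (a + b + e).
  exact: le_trans (d_wD_le_cap _ _) ce.
have half := cap_le_half.
have -> : a + b + e = (a + e / 2) + (b + e / 2) by field.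
apply: matched_d_wD_le => //; first by lra.
apply: (matched_trans dM (Xi := Xi)); try lra.
- by apply: d_wD_lt_matched => //; rewrite -/a; lra.
- by apply: d_wD_lt_matched => //; rewrite -/b; lra.
Qed.

Lemma d_wD_metric (A : set (weighted_set R G)) : A `<=` U ->
  is_metric (restrict_dist (d_wD d r0 sigma) (A := A)).
Proof.
move=> AU; have UA (x : A) : U (val x) by exact/AU/set_valP.
split.
- by move=> x y; exact: d_wD_ge0.
- move=> x; apply/eqP; rewrite eq_le d_wD_ge0 andbT.
  apply/ler_addgt0Pr => e e0; rewrite add0r.
  by apply: matched_d_wD_le => //; exact: matched_refl.
- by move=> x y xy; apply: val_inj; exact: d_wD_eq0 xy.
- by move=> x y; apply/eqP; rewrite eq_le !d_wD_sym_le.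
- by move=> y x z; exact: d_wD_tri.
Qed.

End wD_metric.

(** * Ultralimits, compactness and relative density *)

Section wD_compact.
Context (R : realType) (G : topologicalGroupType) (d : G -> G -> R).
Context (dA : adapted_metric d) (r0 sigma : R).
Context (r0_gt0 : 0 < r0) (sigma_ge1 : 1 <= sigma).
Implicit Types (Pi Xi Th : weighted_set R G) (e : R).

Let dM : is_metric d := adapted_is_metric dA.
Let U : set (weighted_set R G) := calU d r0 sigma.

Section ultralimit.
Context (T : Type) (F : set_system T) (FU : UltraFilter F).
Context (f : T -> weighted_set R G) (fU : forall t, U (f t)).

(** The atoms of the limit: the pairs of a point and a mass that [F]-almost
    every [f t] approximates. *)
Definition ulim_atom (x : G) (a : R) := forall e, 0 < e ->
  F [set t | exists y, [/\ supp (f t) y, d x y < e & `|a - wt (f t) y| < e]].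

Lemma ulim_atom_weight x a : ulim_atom x a -> sigma^-1 <= a <= sigma.
Proof.
move=> La; apply/andP; split; apply/ler_addgt0Pr => e e0;
  have [t [y [/(proj2 (proj1 (calUP _ _ _ sigma_ge1) (fU t)) y)/andP[sy ys] _]]]
    := filter_ex (La e e0); rewrite ltr_norml => /andP[]; lra.
Qed.

(** Points that are approximated simultaneously and lie in a common ball of
    radius [r0] are approximated by one and the same point. *)
Lemma ulim_atom_discrete z x a y b : d z x < r0 -> d z y < r0 ->
  ulim_atom x a -> ulim_atom y b -> x = y /\ a = b.
Proof.
move=> zx zy La Lb.
have near_xy e : 0 < e -> d x y <= e /\ `|a - b| <= e.
  move=> e0; pose e' := Num.min (e / 2) (Num.min (r0 - d z x) (r0 - d z y)).
  have e'0 : 0 < e' by rewrite !lt_min !subr_gt0 divr_gt0//= zx.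
  have e'e : e' <= e / 2 by rewrite ge_min lexx.
  have e'x : e' <= r0 - d z x by rewrite /e' ge_min ge_min lexx !orbT.
  have e'y : e' <= r0 - d z y by rewrite /e' ge_min ge_min lexx !orbT.
  have [t [[p [Pp xp ap]] [q [Pq yq bq]]]] :=
    filter_ex (filterI (La e' e'0) (Lb e' e'0)).
  have pq : p = q.
    apply: (proj1 (fU t) z); split => //.
    - by apply: (le_lt_trans (metric_tri dM x z p)); lra.
    - by apply: (le_lt_trans (metric_tri dM y z q)); lra.
  subst q; split.
    by apply: (le_trans (metric_tri dM p x y)); rewrite (metric_symm dM p); lra.
  apply: (le_trans (ler_distD (wt (f t) p) a b)).
  by rewrite (distrC _ b); lra.
split.
  apply: (metric_eq0 dM); apply/eqP; rewrite eq_le (metric_ge0 dM) andbT.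
  by apply/ler_addgt0Pr => e /near_xy[]; rewrite add0r.
apply/eqP; rewrite -subr_eq0 -normr_eq0 eq_le normr_ge0 andbT.
by apply/ler_addgt0Pr => e /near_xy[]; rewrite add0r.
Qed.

(** Along an ultrafilter, a cluster point in the compact set
    [cball 1 r * [1 / sigma, sigma]] is a limit. *)
Lemma ulim_atom_exists (h : T -> G) r :
  F [set t | supp (f t) (h t) /\ d 1%g (h t) <= r] ->
  exists z a, forall e, 0 < e ->
    F [set t | [/\ supp (f t) (h t), d z (h t) < e &
                   `|a - wt (f t) (h t)| < e]].
Proof.
move=> Fh; pose g t := (h t, wt (f t) (h t)).
pose K : set (G * R) := cball d 1%g r `*` [set` `[sigma^-1, sigma]].
have cK : compact K.
  by apply: compact_setX; [exact: (adapted_proper dA)|exact: segment_compact].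
have FK : (g @ F) K.
  change (F (g @^-1` K)); apply: filterS Fh => t [Pt tr]; split => //=.
  by rewrite in_itv/=; exact: (proj2 (proj1 (calUP _ _ _ sigma_ge1) (fU t))).
have [[z a] [_ clz]] := cK (g @ F) _ FK.
exists z, a => e e0; pose N : set (G * R) := oball d z e `*` ball a e.
have nN : nbhs (z, a) N.
  exists (oball d z e, ball a e) => //; split => /=; last exact: nbhsx_ballx.
  by apply: open_nbhs_nbhs; split; [exact: oball_open|exact: oball_center].
have [FN|FN] := in_ultra_setVsetC (g @^-1` N) FU.
  by apply: filterS2 Fh FN => t [Pt _] [zt at_].
have [y []] := clz (~` N) N FN nN.
by [].
Qed.

Lemma ulim : exists2 Pi, U Pi &
  forall e, 0 < e -> F [set t | matched d e (f t) Pi].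
Proof.
pose P := [set x | exists a, ulim_atom x a].
pose w x := xget 0 [set a | ulim_atom x a].
have Lw x : P x -> ulim_atom x (w x) by move=> [a La]; exact: (xgetI _ La).
have s0 : 0 < sigma^-1 by rewrite invr_gt0 (lt_le_trans ltr01).
have [|Pi PiP Piw] := @weighted_set_of R G P w.
  by move=> x /Lw /ulim_atom_weight /andP[+ _]; exact: lt_le_trans.
exists Pi.
  apply/calUP => //; rewrite PiP; split=> [z x y [zx /Lw Lx] [zy /Lw Ly]|x Px].
    by have [] := ulim_atom_discrete zx zy Lx Ly.
  by rewrite Piw//; exact/ulim_atom_weight/Lw.
move=> e e0; apply: filterI; last first.
  (* finitely many atoms of the limit lie in the window *)
  have finS : finite_set (cball d 1%g e^-1 `&` P).
    apply: (uniformly_discrete_finite dA r0_gt0); last exact: (adapted_proper dA).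
    move=> z x y [zx /Lw Lx] [zy /Lw Ly].
    by have [] := ulim_atom_discrete zx zy Lx Ly.
  pose near_atom x := [set t | exists y,
    [/\ supp (f t) y, d x y < e & `|w x - wt (f t) y| < e]].
  have [S SE] := finite_fsetP.1 finS.
  have : F (\bigcap_(x in [set` S]) near_atom x).
    apply: filter_bigI => x xS.
    have : [set` S] x by [].
    by rewrite -SE => -[_ /Lw]; exact.
  apply: filterS => t tS x; rewrite PiP => Px xe.
  by rewrite Piw//; apply: tS; rewrite -SE; split => //; exact: ltW.
(* otherwise almost every [f t] has an atom [h t] in the window that is far from
   all atoms of the limit, but the [h t] converge to such an atom *)
pose B := [set t | shadowed d e (f t) Pi].
have [//|FB] := in_ultra_setVsetC B FU.
pose far t := [set x | [/\ supp (f t) x, d 1%g x < e^-1 &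
  ~ exists y, [/\ supp Pi y, d x y < e & `|wt (f t) x - wt Pi y| < e]]].
pose h t := xget 1%g (far t).
have Fh : F [set t | far t (h t)].
  apply: filterS FB => t; apply: contra_notP => nfar x Px xe.
  apply: contrapT => nx; apply: nfar.
  by apply: xgetPex; exists x.
have [|z [a za]] := @ulim_atom_exists h e^-1.
  by apply: filterS Fh => t [Pt te _]; split => //; exact: ltW.
have Lz : ulim_atom z a.
  by move=> e' /za; apply: filterS => t [*]; exists (h t).
have Pz : P z by exists a.
have wz : wt Pi z = a.
  rewrite Piw//; have zz : d z z < r0 by rewrite (metric_xx dM).
  by have [] := ulim_atom_discrete zz zz (Lw z Pz) Lz.
have [t [[_ _ nt] [_ zt wzt]]] := filter_ex (filterI Fh (za e e0)).
exfalso; apply: nt; exists z; split; first by rewrite PiP.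
  by rewrite (metric_symm dM).
by rewrite wz distrC.
Qed.

End ultralimit.

(** Stated for subsets of [calU] that are closed under limits, so that it applies
    to both [calU] and [Del]. *)
Lemma metric_space_compact (A : set (weighted_set R G))
    (dP : is_metric (restrict_dist (d_wD d r0 sigma) (A := A))) :
  A `<=` U ->
  (forall Pi, U Pi ->
    (forall e, 0 < e -> exists2 Xi, A Xi & matched d e Xi Pi) -> A Pi) ->
  compact [set: metric_space dP].
Proof.
move=> AU Acl; rewrite compact_ultra => F FU _.
have UA (x : A) : U (val x) by exact/AU/set_valP.
have [Pi UPi FPi] := @ulim (metric_space dP) F FU (fun x => val (x : A)) UA.
have APi : A Pi.
  apply: Acl => // e /FPi/filter_ex[x xPi].
  by exists (val (x : A)) => //; exact: set_valP.
exists (SigSub (mem_set APi)); split => // V /nbhs_ballP[e /= e0 eV].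
have e20 : 0 < e / 2 by rewrite divr_gt0.
apply: filterS (FPi _ e20) => x xPi; apply: eV.
rewrite ballEmdist /= -[X in X < _]/(d_wD d r0 sigma Pi (val (x : A))).
apply: (@le_lt_trans _ _ (e / 2)); last by rewrite ltr_pdivrMr// ltr_pMr// ltr1n.
by apply: matched_d_wD_le => //; [exact: UA|exact: matched_sym].
Qed.

Lemma finite_gap (T : eqType) (s : seq T) (g : T -> R) a :
  (forall x, x \in s -> a < g x) ->
  exists2 b, a < b & forall x, x \in s -> b <= g x.
Proof.
elim: s => [|x s IH] xs; first by exists (a + 1); rewrite ?ltrDl.
have [|b ab bs] := IH; first by move=> y ys; apply: xs; rewrite inE ys orbT.
exists (Num.min b (g x)); first by rewrite lt_min ab xs// mem_head.
move=> y; rewrite inE => /orP[/eqP->|/bs]; first by rewrite ge_min lexx orbT.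
by rewrite ge_min => ->.
Qed.

(** If all points of [Pi] were at distance more than [R0] from [g], there would
    be a gap [b > R0], because only finitely many of them are at distance at most
    [R0 + 1]; a relatively dense [Xi] sufficiently close to [Pi] has a point
    within [R0] of [g], and its match in [Pi] violates the gap. *)
Lemma Del_limit R0 Pi : U Pi ->
  (forall e, 0 < e -> exists2 Xi, Del d r0 R0 sigma Xi & matched d e Xi Pi) ->
  Del d r0 R0 sigma Pi.
Proof.
move=> UPi PiD; split => //; apply/seteqP; split => // g _.
apply: contrapT => gP.
have finS := uniformly_discrete_finite dA r0_gt0 (proj1 UPi)
  (@adapted_proper _ _ _ dA g (R0 + 1)).
have /finite_seqP[s sE] := finS.
have [|b Rb bs] := @finite_gap G s (fun x => d x g) R0.
  move=> x xs; have : [set` s] x by [].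
  by rewrite -sE => -[_ Px]; rewrite ltNge; apply/negP => xg; apply: gP; exists x.
pose M := Num.max (d 1%g g + R0) 0 + 1.
have M0 : 0 < M by rewrite ltr_wpDl// le_max lexx orbT.
have MR : d 1%g g + R0 < M by rewrite ltr_pwDr// le_max lexx.
pose e := Num.min (Num.min 1 (b - R0)) M^-1.
have e0 : 0 < e by rewrite !lt_min ltr01 subr_gt0 Rb invr_gt0.
have e1 : e <= 1 by rewrite /e ge_min ge_min lexx.
have eb : e <= b - R0 by rewrite /e ge_min ge_min lexx orbT.
have eM : M <= e^-1.
  by rewrite -[leLHS]invrK lef_pV2// ?posrE ?invr_gt0// /e ge_min lexx orbT.
have [Xi [_ Xid] [XiPi _]] := PiD e e0.
have : [set: G] g by [].
rewrite Xid => -[x Xix]; rewrite /cball/= => xg.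
have [|y [Py xy _]] := XiPi x Xix.
  apply: (le_lt_trans (metric_tri dM g _ _)); rewrite (metric_symm dM g).
  by lra.
have yg : d y g < R0 + e.
  by apply: (le_lt_trans (metric_tri dM x _ _)); rewrite (metric_symm dM y); lra.
have ys : y \in s.
  have : [set` s] y by rewrite -sE; split => //; rewrite /cball/= (metric_symm dM); lra.
  by [].
by have := bs y ys; lra.
Qed.

Lemma closed_Del R0 (dP : is_metric (restrict_dist (d_wD d r0 sigma) (A := U))) :
  closed ([set Pi | Del d r0 R0 sigma (val Pi)] : set (metric_space dP)).
Proof.
move=> p clp; apply: Del_limit; first exact: set_valP.
have c0 := cap_gt0 r0_gt0 sigma_ge1.
move=> e e0; pose e' := Num.min e (cap r0 sigma).
have e'0 : 0 < e' by rewrite lt_min e0.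
have [q [Dq]] := clp _ (nbhsx_ballx p _ e'0).
rewrite ballEmdist /= -[X in X < _]/(d_wD d r0 sigma (val (p : U)) (val (q : U))) => pq.
exists (val (q : U)) => //; apply: (@matched_le _ _ _ e') => //.
  by rewrite /e' ge_min lexx.
apply: matched_sym; apply: (d_wD_lt_matched dM r0_gt0 sigma_ge1) pq.
- exact: set_valP.
- exact: set_valP.
- by rewrite /e' ge_min lexx orbT.
Qed.

End wD_compact.

(** * Integrals against a weighted set *)

Lemma integral_msum_dirac disp (T : measurableType disp) (R : realType)
    (w : nat -> {nonneg R}) (a : nat -> T) n (f : T -> R) :
  measurable_fun setT f ->
  (\int[msum (fun k => mscale (w k) (dirac (a k))) n]_x (f x)%:E =
   (\sum_(k < n) (w k)%:num * f (a k))%:E)%E.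
Proof.
move=> mf; have mEf : measurable_fun setT (EFin \o f) by exact/measurable_EFinP.
have ge0_integral (g : T -> \bar R) : (forall x, 0 <= g x)%E ->
    measurable_fun setT g ->
    (\int[msum (fun k => mscale (w k) (dirac (a k))) n]_x g x =
     \sum_(k < n) (w k)%:num%:E * g (a k))%E.
  move=> g0 mg; rewrite ge0_integral_measure_sum//; apply: eq_bigr => k _.
  rewrite ge0_integral_mscale//=.
  by rewrite integral_dirac// diracT mul1e.
rewrite integralE !ge0_integral//; last 2 first.
  exact: measurable_funeneg.
  exact: measurable_funepos.
under eq_bigr do rewrite funeposE /= -EFin_max -EFinM.
under [X in (_ - X)%E]eq_bigr do rewrite funenegE /= -EFin_max -EFinM.
rewrite !sumEFin -EFinB /= -sumrB; congr EFin; apply: eq_bigr => x _.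
rewrite -mulrBr; congr (_ * _).
by rewrite /Num.max; case: ltP => ?; case: ltP => ?; lra.
Qed.

Section integral_weighted_set.
Context (R : realType) (G : topologicalGroupType).
Implicit Types (Pi : weighted_set R G) (phi : G -> R) (s : seq G).

Lemma continuous_borel phi : continuous phi ->
  measurable_fun [set: borel G] (phi : borel G -> R).
Proof.
move=> cphi; apply: (measurability _ (RGenOpens.measurableE R)).
move=> _ [_ [a [b ->] <-]]; rewrite setTI; apply: sub_sigma_algebra.
by move/continuousP : cphi; apply; exact: interval_open.
Qed.

Lemma mu_of_atoms Pi s (A : set G) : uniq s ->
  (forall x, A x -> supp Pi x -> x \in s) ->
  mu_of Pi A = msum (fun k => mscale (NngNum (wt_ge0 Pi (nth 1%g s k)))
    (dirac (nth 1%g s k : borel G))) (size s) A.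
Proof.
move=> us As; rewrite mu_of_wt /msum/=.
rewrite [RHS](_ : _ =
    \sum_(x <- s) (wt Pi x)%:E * \d_(x : borel G) (A : set (borel G)))%E; last first.
  by rewrite (big_nth 1%g) big_mkord.
rewrite (fsbig_seq _ (fun x : G => (wt Pi x)%:E * \d_(x : borel G) (A : set (borel G))))%E//.
rewrite -esum_fset//; last first.
  by move=> x _; rewrite mule_ge0// lee_fin wt_ge0.
rewrite [LHS]esum_mkcond [RHS]esum_mkcond; apply: eq_esum => x _.
rewrite diracE.
case: ifPn => xA; last by rewrite mule0 if_same.
rewrite mule1; case: ifPn => // /negP xs; rewrite wt_out// => Px; apply: xs.
by apply: mem_set; exact: As (set_mem xA) Px.
Qed.

(** Any finite list containing the atoms that [phi] sees may index the sum; the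
    freedom in the list lets the integrals of nearby weighted sets be written
    over the same index set. On the set where [phi] does not vanish, [mu_of Pi]
    agrees with a finite sum of Dirac measures. *)
Lemma Rintegral_weighted_set Pi s phi : uniq s -> continuous phi ->
  (forall x, supp Pi x -> phi x != 0 -> x \in s) ->
  (\int[mu_of Pi]_x phi x)%R = \sum_(x <- s) wt Pi x * phi x.
Proof.
move=> us cphi sphi; pose D : set G := [set x | phi x != 0].
have restr : (EFin \o phi) \_ D = EFin \o phi.
  apply/funext => x; rewrite /patch; case: ifPn => //= /negP xD.
  congr EFin; apply/esym/eqP/negPn/negP => px; apply: xD.
  exact: mem_set.
have mD : measurable (D : set (borel G)).
  apply: sub_sigma_algebra.
  rewrite [X in open X](_ : _ = phi @^-1` [set y | y != 0])//.
  by apply: open_comp => [? _|]; [exact: cphi|exact: open_neq].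
rewrite /Rintegral -[X in fine X]/(integral (mu_of Pi) setT (EFin \o phi)).
rewrite -restr -integral_mkcond.
rewrite (eq_measure_integral (msum (fun k => mscale (NngNum (wt_ge0 Pi (nth 1%g s k)))
    (dirac (nth 1%g s k : borel G))) (size s))); last first.
  by move=> A mA AD; apply: mu_of_atoms => // x /AD px Px; exact: sphi.
rewrite integral_mkcond restr integral_msum_dirac; last exact: continuous_borel.
by rewrite /= (big_nth 1%g) big_mkord.
Qed.

End integral_weighted_set.

(** * Comparison with the weak* topology *)

Lemma injective_continuous_hausdorff (X Y : topologicalType) (f : X -> Y) :
  injective f -> continuous f -> hausdorff_space Y -> hausdorff_space X.
Proof.
move=> inj_f cf hY p q pq; apply: inj_f; apply: hY => A B /cf fA /cf fB.
by have [x [Ax Bx]] := pq _ _ fA fB; exists (f x).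
Qed.

Lemma ptws_cvg (I : Type) (Y : topologicalType) (F : set_system {ptws I -> Y})
    (g : {ptws I -> Y}) : Filter F ->
  (forall i, (fun h : {ptws I -> Y} => h i) @ F --> g i) -> F --> g.
Proof.
move=> FF Fg; apply/cvg_sup => i A.
rewrite nbhsE => -[B [[V oV <-] Vg] VA]; apply: filterS VA _.
by apply: (Fg i); exact: open_nbhs_nbhs.
Qed.

Section weak_star.
Context (R : realType) (G : topologicalGroupType) (d : G -> G -> R).
Context (dA : adapted_metric d) (r0 sigma : R).
Context (r0_gt0 : 0 < r0) (sigma_ge1 : 1 <= sigma).
Implicit Types (Pi Xi : weighted_set R G) (e : R).

Let dM : is_metric d := adapted_is_metric dA.
Let U : set (weighted_set R G) := calU d r0 sigma.

Lemma dist_continuous x : continuous (d x).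
Proof.
move=> y; apply: (@continuous_comp _ _ _ (fun z : G => (x, z))
  (fun xy : G * G => d xy.1 xy.2)); last exact: (adapted_continuous dA).
by apply: cvg_pair; [exact: cvg_cst|exact: cvg_id].
Qed.

Lemma cball_closed x r : closed (cball d x r).
Proof.
rewrite (_ : cball d x r = d x @^-1` [set t | t <= r])//.
by apply: closed_comp => [? _|]; [exact: dist_continuous|exact: closed_le].
Qed.

(** Continuity of [d] makes balls open; that they form a basis follows from
    properness: points approaching [x] for the metric stay in a compact
    ball, and [x] is the only point where they can cluster. *)
Lemma nbhs_oball (x : G) (V : set G) : nbhs x V ->
  exists2 r, 0 < r & oball d x r `<=` V.
Proof.
move=> xV; apply: contrapT => nr.
pose F := filter_from [set r : R | 0 < r] (fun r => oball d x r `&` ~` V).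
have PF : ProperFilter F.
  apply: filter_from_proper; first apply: filter_from_filter.
  - by exists 1 => /=.
  - move=> r1 r2 /= r10 r20; exists (Num.min r1 r2); first by rewrite /= lt_min r10.
    by move=> y [+ nV]; rewrite /oball/= lt_min => /andP[].
  - move=> r r_gt0; apply: contrapT => r0V; apply: nr; exists r => // y xy.
    by apply: contrapT => nVy; apply: r0V; exists y.
have FK : F (cball d x 1) by exists 1 => //= y [/ltW].
have [z [_ zF]] := adapted_proper dA PF FK.
have xz : x = z.
  apply: (metric_eq0 dM); apply/eqP; rewrite eq_le (metric_ge0 dM) andbT.
  apply/ler_addgt0Pr => e e0; rewrite add0r.
  have e20 : 0 < e / 2 by rewrite divr_gt0.
  have [|y [[xy _] zy]] := zF (oball d x (e / 2) `&` ~` V) (oball d z (e / 2)) _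
    (open_nbhs_nbhs (conj (oball_open dA z (e / 2)) (oball_center dA z e20))).
    by exists (e / 2).
  apply: (le_trans (metric_tri dM y _ _)); rewrite (metric_symm dM y).
  by move: xy zy; rewrite /oball/=; lra.
subst z; have [|y [[_ nVy] Vy]] := zF (oball d x 1 `&` ~` V) V _ xV.
  by exists 1 => /=.
by [].
Qed.

Lemma cvg_dist (T : Type) (F : set_system T) (h : T -> G) (x : G) : Filter F ->
  (forall e, 0 < e -> F [set t | d x (h t) < e]) -> h @ F --> x.
Proof.
move=> FF Fh V /nbhs_oball[r r_gt0 rV].
by apply: filterS (Fh r r_gt0) => t; exact: rV.
Qed.

Lemma compact_cball (K : set G) : compact K ->
  exists2 M, 0 < M & K `<=` cball d 1%g M.
Proof.
move=> cK; have : compact (d 1%g @` K : set R^o).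
  apply: continuous_compact => //; apply: continuous_subspaceT.
  exact: dist_continuous.
move=> /compact_bounded[M [_ KM]].
exists (Num.max M 0 + 1); first by rewrite ltr_wpDl// le_max lexx orbT.
move=> x Kx; rewrite /cball/= -[leLHS]ger0_norm ?(metric_ge0 dM)//.
by apply: KM; [rewrite ltr_pwDr// le_max lexx|exists x].
Qed.

Section integral_continuity.
Context (T : Type) (F : set_system T) (FF : Filter F).
Context (f : T -> weighted_set R G) (fU : forall t, U (f t)).
Context (Pi : weighted_set R G) (UPi : U Pi).
Context (fPi : forall e, 0 < e -> F [set t | matched d e (f t) Pi]).
Context (phi : G -> R) (Cphi : Cc phi).

(** For [t] far along [F], the atoms of [f t] that [phi] sees are in bijection
    with the atoms of [Pi] in a fixed ball, so the two integrals are sums with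
    the same finite index set and the terms converge one by one. *)
Lemma Rintegral_cvg :
  (\int[mu_of (f t)]_x phi x)%R @[t --> F] --> (\int[mu_of Pi]_x phi x)%R.
Proof.
have [cphi cK] := Cphi.
have [M M0 KM] := compact_cball cK.
have phiM y : phi y != 0 -> d 1%g y <= M.
  by move=> py; apply: KM; exact: subset_closure.
have := @adapted_proper _ _ _ dA 1%g (M + 1).
move=> /(uniformly_discrete_finite dA r0_gt0 (proj1 UPi)) /finite_seqP[s' s'E].
pose s := undup s'.
have sP x : x \in s <-> d 1%g x <= M + 1 /\ supp Pi x.
  rewrite mem_undup -[X in X <-> _]/([set` s'] x) -s'E.
  by split => -[].
(* the atom of [f t] near the atom [x] of [Pi], if there is one *)
pose h t x := xget x [set y | supp (f t) y /\ d x y < r0].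
(* below [e0], the window contains the ball of radius [M + 1] where the atoms of
   [Pi] are listed, and matching is injective *)
pose e0 := Num.min (Num.min r0 1) (M + 2)^-1.
have M20 : 0 < M + 2 by rewrite addr_gt0.
have e00 : 0 < e0 by rewrite !lt_min r0_gt0 ltr01 invr_gt0.
have e0r : e0 <= r0 by rewrite /e0 ge_min ge_min lexx.
have e01 : e0 <= 1 by rewrite /e0 ge_min ge_min lexx orbT.
have e0M e : 0 < e -> e <= e0 -> M + 2 <= e^-1.
  move=> e_gt0 ee0; rewrite -[leLHS]invrK lef_pV2// ?posrE ?invr_gt0//.
  by rewrite (le_trans ee0)// /e0 ge_min lexx orbT.
have hE t x y : supp (f t) y -> d x y < r0 -> h t x = y.
  move=> fy xy; have [fh xh] : [set y | supp (f t) y /\ d x y < r0] (h t x).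
    exact: (xgetI _ (conj fy xy)).
  by apply: (proj1 (fU t) x).
have hP t e x : 0 < e -> e <= e0 -> matched d e (f t) Pi -> x \in s ->
    [/\ supp (f t) (h t x), d x (h t x) < e &
        `|wt Pi x - wt (f t) (h t x)| < e].
  move=> e_gt0 ee0 [_ Pif] /sP[xM Px]; have [|y [fy xy wxy]] := Pif x Px.
    by rewrite (lt_le_trans _ (e0M e e_gt0 ee0))//; lra.
  by rewrite (hE t x y)//; lra.
have fE : \forall t \near F, \sum_(x <- s) wt (f t) (h t x) * phi (h t x) =
    (\int[mu_of (f t)]_x phi x)%R.
  apply: filterS (fPi e00) => t mt.
  rewrite (@Rintegral_weighted_set _ _ _ (map (h t) s))//.
  - by rewrite big_map.
  - rewrite map_inj_in_uniq ?undup_uniq// => x y xs ys hxy.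
    have [_ hx _] := hP t e0 x e00 (lexx _) mt xs.
    have [_ hy _] := hP t e0 y e00 (lexx _) mt ys.
    apply: (proj1 UPi (h t x)).
    + split; last by have /sP[] := xs.
      by rewrite /oball/= (metric_symm dM); lra.
    + split; last by have /sP[] := ys.
      by rewrite hxy /oball/= (metric_symm dM); lra.
  - move=> y fy /phiM yM; have [|x [Px yx _]] := proj1 mt y fy.
      by rewrite (lt_le_trans _ (e0M e0 e00 (lexx _)))//; lra.
    apply/mapP; exists x; last first.
      by apply/esym/hE => //; rewrite (metric_symm dM); lra.
    apply/sP; split => //.
    by apply: (le_trans (metric_tri dM y _ _)); lra.
rewrite (@Rintegral_weighted_set _ _ _ s) ?undup_uniq//; last first.
  by move=> x Px /phiM xM; apply/sP; split => //; lra.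
apply: cvg_trans (near_eq_cvg fE) _.
rewrite [\sum_(x <- s) wt Pi x * phi x]big_seq; under eq_fun do rewrite big_seq.
apply: cvg_big => [|x xs]; first exact: add_continuous.
have hx e : 0 < e -> F [set t | d x (h t x) < e /\
    `|wt Pi x - wt (f t) (h t x)| < e].
  move=> e_gt0; pose e' := Num.min e e0.
  have e'0 : 0 < e' by rewrite lt_min e_gt0.
  have e'e : e' <= e by rewrite /e' ge_min lexx.
  have e'e0 : e' <= e0 by rewrite /e' ge_min lexx orbT.
  apply: filterS (fPi e'0) => t mt.
  by have [_ xh wxh] := hP t e' x e'0 e'e0 mt xs; split; lra.
apply: cvgM.
  by apply/cvgrPdist_lt => e /hx; apply: filterS => t [].
apply: (@cvg_comp _ _ _ (h ^~ x) phi F (nbhs x)); last exact: cphi.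
by apply: cvg_dist => e /hx; apply: filterS => t [].
Qed.

End integral_continuity.

Lemma isolated_atom Pi x : U Pi ->
  exists2 r, 0 < r & forall y, supp Pi y -> d x y < r -> y = x.
Proof.
move=> [Pd _].
have [[y [Py xy yx]]|noy] := pselect (exists y, [/\ supp Pi y, d x y < r0 & y <> x]).
  exists (d x y).
    rewrite lt_neqAle (metric_ge0 dM) andbT eq_sym.
    by apply/eqP => /(metric_eq0 dM)/esym.
  move=> z Pz xz; have zy : z = y by apply: (Pd x); split => //; exact: lt_trans xy.
  by move: xz; rewrite zy ltxx.
by exists r0 => // y Py xy; apply: contrapT => yx; apply: noy; exists y.
Qed.

Definition bump (x : G) (r : R) (y : G) : R := Num.max 0 (r - d x y).

Lemma bump_Cc x r : Cc (bump x r).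
Proof.
split.
  move=> y; apply: (@continuous_max _ _ (cst 0) (fun y => r - d x y)).
    exact: cvg_cst.
  by apply: cvgB; [exact: cvg_cst|exact: dist_continuous].
apply: (subclosed_compact _ (@adapted_proper _ _ _ dA x r)).
  exact: closed_closure.
rewrite [X in _ `<=` X](closure_id _).1; last exact: cball_closed.
apply: closure_subset => y; rewrite /bump /cball /= => yr.
rewrite leNgt; apply: contra_neqN yr => ry; apply/max_idPl.
by rewrite subr_le0 ltW.
Qed.

Lemma Rintegral_inj Pi Xi : U Pi -> U Xi ->
  (forall phi, Cc phi ->
    (\int[mu_of Pi]_x phi x)%R = (\int[mu_of Xi]_x phi x)%R) -> Pi = Xi.
Proof.
move=> UP UX PX; apply: wt_inj => x.
have [r r_gt0 Pr] := isolated_atom x UP.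
have [t t_gt0 Xt] := isolated_atom x UX.
pose q := Num.min r t.
have q_gt0 : 0 < q by rewrite lt_min r_gt0.
have bump_in y : bump x q y != 0 -> d x y < r /\ d x y < t.
  move=> bq; suff : d x y < q by rewrite lt_min => /andP[].
  rewrite ltNge; apply: contra_neqN bq => ry; apply/max_idPl.
  by rewrite subr_le0.
have bump_x : bump x q x = q.
  by rewrite /bump (metric_xx dM) subr0; apply/max_idPr; exact: ltW.
have [cb _] := bump_Cc x q.
have := PX _ (bump_Cc x q).
rewrite !(@Rintegral_weighted_set _ _ _ [:: x])//.
- by rewrite !big_seq1 bump_x => /mulIf; apply; rewrite gt_eqF.
- by move=> y Xy /bump_in[_ yt]; rewrite inE (Xt y).
- by move=> y Py /bump_in[yr _]; rewrite inE (Pr y).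
Qed.

Let pairing (Pi : U) : {ptws @Cc R G -> R} :=
  radon_eval (radon_of dA r0_gt0 Pi).

Lemma pairing_inj : injective pairing.
Proof.
move=> p q pq; apply: val_inj; apply: Rintegral_inj; [exact: set_valP..|].
move=> phi Cphi.
exact: (congr1 (fun g => g (SigSub (mem_set Cphi))) pq).
Qed.

Lemma weak_star_open (W : set U) :
  open (W : set (initial_topology (@radon_of R G d dA r0 sigma r0_gt0))) <->
  exists2 V : set {ptws @Cc R G -> R}, open V & pairing @^-1` V = W.
Proof.
split=> [[_ [V oV <-] <-]|[V oV VW]]; first by exists V.
by exists (@radon_eval R G @^-1` V) => //; exists V.
Qed.

Lemma weak_star_hausdorff : hausdorff_space
  (initial_topology (@radon_of R G d dA r0 sigma r0_gt0)).
Proof.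
apply: (@injective_continuous_hausdorff
  (initial_topology (@radon_of R G d dA r0 sigma r0_gt0))
  {ptws @Cc R G -> R} pairing pairing_inj).
  apply/continuousP => V oV; apply/weak_star_open; by exists V.
by apply: hausdorff_product => ?; exact: Rhausdorff.
Qed.

Section metric.
Context (dP : is_metric (restrict_dist (d_wD d r0 sigma) (A := U))).

Lemma pairing_continuous : continuous (pairing : metric_space dP -> _).
Proof.
move=> p; apply: ptws_cvg => [|phi]; first exact: (@fmap_filter _ _ _ (nbhs p) _).
apply: (@Rintegral_cvg (metric_space dP) (nbhs p) _ (fun x => val (x : U))).
- by move=> t; exact: set_valP.
- exact: set_valP.
- move=> e e_gt0; have c0 := cap_gt0 r0_gt0 sigma_ge1.
  pose e' := Num.min e (cap r0 sigma).
  have e'0 : 0 < e' by rewrite lt_min e_gt0.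
  apply: filterS (nbhsx_ballx p _ e'0) => q; rewrite ballEmdist /=.
  rewrite -[X in X < _]/(d_wD d r0 sigma (val (p : U)) (val (q : U))) => pq.
  apply: (@matched_le _ _ _ e') => //; first by rewrite /e' ge_min lexx.
  apply: matched_sym; apply: (d_wD_lt_matched dM r0_gt0 sigma_ge1) pq.
  + exact: set_valP.
  + exact: set_valP.
  + by rewrite /e' ge_min lexx orbT.
- exact: set_valP.
Qed.

(** The image of a metrically closed, hence compact, set is weak* compact, hence
    weak* closed. *)
Lemma wD_weak_star (W : set U) : compact [set: metric_space dP] ->
  open (W : set (metric_space dP)) <->
  open (W : set (initial_topology (@radon_of R G d dA r0 sigma r0_gt0))).
Proof.
move=> cU; have weak_metric (V : set U) :
    open (V : set (initial_topology (@radon_of R G d dA r0 sigma r0_gt0))) ->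
    open (V : set (metric_space dP)).
  move=> /weak_star_open[V' oV' <-].
  by have /continuousP := pairing_continuous; exact.
split=> [oW|]; last exact: weak_metric.
pose S := metric_space dP.
pose X := initial_topology (@radon_of R G d dA r0 sigma r0_gt0).
have id_continuous : continuous (idfun : S -> X).
  by apply/continuousP => V; exact: weak_metric.
have cWC : compact (~` (W : set S)).
  by apply: (subclosed_compact _ cU) => //; exact: open_closedC.
have := @continuous_compact S X idfun _ (continuous_subspaceT id_continuous) cWC.
rewrite image_id => /(compact_closed weak_star_hausdorff)/closed_openC.
by rewrite setCK.
Qed.

End metric.
End weak_star.

(** * The theorem *)

Theorem proposition3p15 (R : realType) (G : topologicalGroupType)
    (lcG : locally_compact [set: G]) (scG : @second_countable G)
    (hsG : hausdorff_space G)
    (d : G -> G -> R) (dA : adapted_metric d)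
    (r0 R0 sigma : R) (r0_gt0 : 0 < r0) (R0_gt0 : 0 < R0)
    (sigma_ge1 : 1 <= sigma) :
  (exists dP : is_metric (restrict_dist (d_wD d r0 sigma)
                            (A := calU d r0 sigma)),
    [/\ compact [set: metric_space dP],
        forall W : set (calU d r0 sigma),
          open (W : set (metric_space dP)) <->
          open (W : set (initial_topology
                           (@radon_of R G d dA r0 sigma r0_gt0)))
      & closed ([set Pi | Del d r0 R0 sigma (val Pi)]
                  : set (metric_space dP))]) /\
  Del d r0 R0 sigma `<=` calU d r0 sigma /\
  (exists dP : is_metric (restrict_dist (d_wD d r0 sigma)
                            (A := Del d r0 R0 sigma)),
    compact [set: metric_space dP]).
Proof.
have dM := adapted_is_metric dA.
have DU : Del d r0 R0 sigma `<=` calU d r0 sigma by move=> Pi [].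
have UP := d_wD_metric dM r0_gt0 sigma_ge1 (@subset_refl _ (calU d r0 sigma)).
have DP := d_wD_metric dM r0_gt0 sigma_ge1 DU.
have cU : compact [set: metric_space UP].
  exact: (metric_space_compact dA r0_gt0 sigma_ge1).
split; last split => //.
  exists UP; split=> [//|W|]; first exact: wD_weak_star.
  exact: closed_Del.
exists DP; apply: (metric_space_compact dA r0_gt0 sigma_ge1) => // Pi UPi PiD.
exact: (Del_limit dA r0_gt0).
Qed.
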